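(* Let $X$ be a real reflexive Banach space with dual $Y$, let $\phi \in \Gamma_0(X)$ and let $\varepsilon > 0$. Let $$M(\phi,\varepsilon) = \{ (x,y) \in X \times Y : \text{there is } a \in Y \text{ with } \|a\| \leq \varepsilon \text{ and } y + a \in \partial \phi(x) \},$$ and let $b : X\times Y \to \mathbb{R}\cup\{+\infty\}$ be the function defined by $$b(x,y) = \phi(x) + \inf_{a \in Y,\ \|a\|\leq\varepsilon}\left[\phi^{*}(y-a) + \langle x,a\rangle\right].$$ If $b$ is convex in the first variable (that is, $b(\cdot,y)$ is convex for every $y\in Y$), then $b$ is a bipotential and $M(b) = M(\phi,\varepsilon)$.
   Context: $X$ is a real reflexive Banach space, $Y = X^*$ its dual, $\langle x,y\rangle = y(x)$, and $\|\cdot\|$ denotes both the norm of $X$ and the dual norm of $Y$. By reflexivity, the dual of $Y$ is identified with $X$. Conventions: $\bar{\mathbb{R}} = \mathbb{R}\cup\{+\infty\}$; $a + (+\infty) = +\infty$ for $a\in\bar{\mathbb{R}}$, and $a\cdot(+\infty) = +\infty$ for all $a \geq 0$. For $\psi: X \to \bar{\mathbb{R}}$, $\mathrm{dom}\,\psi = \{x : \psi(x) \in \mathbb{R}\}$. $\Gamma_0(X)$ is the set of convex lower semicontinuous functions $\psi : X \to \bar{\mathbb{R}}$ with $\mathrm{dom}\,\psi \neq \emptyset$; $\Gamma_0(Y)$ is defined similarly. The subdifferential is $\partial\psi(x) = \{u \in Y : \langle z - x, u\rangle \leq \psi(z) - \psi(x)\ \forall z \in X\}$, understood to be empty if $\psi(x)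 = +\infty$; for functions on $Y$ the subdifferential is a subset of $X$, defined analogously. The Fenchel conjugate of $\phi$ is $\phi^*(y) = \sup_{x\in X}(\langle x,y\rangle - \phi(x))$. A bipotential is a function $b : X\times Y \to \bar{\mathbb{R}}$ such that: (a) for any $x\in X$, if $\mathrm{dom}\, b(x,\cdot) \neq \emptyset$ then $b(x,\cdot)\in\Gamma_0(Y)$; for any $y \in Y$, if $\mathrm{dom}\, b(\cdot,y)\neq\emptyset$ then $b(\cdot,y)\in\Gamma_0(X)$; (b) $b(x,y)\geq\langle x,y\rangle$ for all $(x,y) \in X\times Y$; (c) for all $(x,y)\in X\times Y$: $y\in\partial b(\cdot,y)(x) \iff x\in\partial b(x,\cdot)(y) \iff b(x,y)=\langle x,y\rangle$. The graph of $b$ is $M(b) = \{(x,y)\in X\times Y : b(x,y)=\langle x,y\rangle\}$. *)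

(* Defs.v *)
From HB Require Import structures.
From mathcomp Require Import all_boot all_order all_algebra.
From mathcomp Require Import all_classical all_reals all_analysis.

Set Implicit Arguments.
Unset Strict Implicit.
Unset Printing Implicit Defensive.

Import Order.TTheory GRing.Theory Num.Theory.
Import numFieldNormedType.Exports.

Local Open Scope classical_set_scope.
Local Open Scope ring_scope.

Section Dual.
Context {R : realType} {X : normedModType R}.

Definition dual_pred : {pred (X -> R^o)} :=
  mem [set f : X -> R^o | linear f /\ continuous f].

Record dual := Dual { dual_fun :> X -> R^o; _ : dual_fun \in dual_pred }.

HB.instance Definition _ := [isSub for dual_fun].
HB.instance Definition _ := [Choice of dual by <:].

Lemma dual_submod_closed : submod_closed dual_pred.
Proof.
split=> [|k f g]; rewrite !inE /=.
  by split=> [k x y|x]; [rewrite /= scaler0 addr0 | exact: cvg_cst].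
move=> [lf cf] [lg cg]; split=> [l x y|x].
  change (k *: f (l *: x + y) + g (l *: x + y) =
          l *: (k *: f x + g x) + (k *: f y + g y)).
  rewrite lf lg !scalerDr !scalerA addrACA.
  by rewrite [k * l]mulrC.
change ((k *: f u + g u) @[u --> x] --> k *: f x + g x).
by apply: cvgD; [apply: cvgZr; exact: cf | exact: cg].
Qed.

HB.instance Definition _ :=
  GRing.isSubmodClosed.Build R (X -> R^o) dual_pred dual_submod_closed.
HB.instance Definition _ := [SubChoice_isSubLmodule of dual by <:].

Lemma dual_linear (f : dual) : linear f.
Proof. by case: f => f /=; rewrite inE => -[]. Qed.

Lemma dual_continuous (f : dual) : continuous f.
Proof. by case: f => f /=; rewrite inE => -[]. Qed.

HB.instance Definition _ (f : dual) :=
  GRing.isLinear.Build R X R^o _ (dual_fun f) (dual_linear f).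

Definition dual_norm (f : dual) : R :=
  sup [set `|f x| | x in [set x : X | `|x| <= 1]].

Lemma dualDE (f g : dual) x : (f + g) x = f x + g x. Proof. by []. Qed.

Lemma dualZE k (f : dual) x : (k *: f) x = k *: f x. Proof. by []. Qed.

Lemma dual_eqP (f g : dual) : f =1 g -> f = g.
Proof. by move=> fg; apply/val_inj/funext. Qed.

Lemma dual_norm_has_sup (f : dual) :
  has_sup [set `|f x| | x in [set x : X | `|x| <= 1]].
Proof.
split; first by exists `|f 0|, 0 => //=; rewrite normr0.
have /bounded_funP/(_ 1)[M fM] : bounded_near f (nbhs (0 : X)).
  by apply/linear_bounded_continuous; exact: dual_continuous.
by exists M => _ [x /= x1 <-]; exact: fM.
Qed.

Lemma dual_norm_ub (f : dual) x : `|x| <= 1 -> `|f x| <= dual_norm f.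
Proof.
by move=> x1; apply: ub_le_sup; [case: (dual_norm_has_sup f)|exists x].
Qed.

Lemma dual_norm_le (f : dual) (M : R) :
  (forall x, `|x| <= 1 -> `|f x| <= M) -> dual_norm f <= M.
Proof.
move=> fM; apply: ge_sup; first by case: (dual_norm_has_sup f).
by move=> _ [x /= x1 <-]; exact: fM.
Qed.

Lemma ler_dual_norm (f : dual) x : `|f x| <= dual_norm f * `|x|.
Proof.
have [->|x0] := eqVneq x 0; first by rewrite linear0 !normr0 mulr0.
have nx : 0 < `|x| by rewrite normr_gt0.
have := @dual_norm_ub f (`|x|^-1 *: x).
rewrite normrZ normfV normr_id mulVf ?gt_eqF// => /(_ (lexx _)).
by rewrite linearZ /= normrZ normfV normr_id ler_pdivrMl // mulrC.
Qed.

Lemma dual_normD (f g : dual) : dual_norm (f + g) <= dual_norm f + dual_norm g.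
Proof.
apply: dual_norm_le => x x1; rewrite dualDE (le_trans (ler_normD _ _))//.
by rewrite lerD// dual_norm_ub.
Qed.

Lemma dual_norm_ge0 (f : dual) : 0 <= dual_norm f.
Proof. by apply: (le_trans _ (@dual_norm_ub f 0 _)); rewrite ?normr0. Qed.

Lemma dual_normZ k (f : dual) : dual_norm (k *: f) = `|k| * dual_norm f.
Proof.
have le l (g : dual) : dual_norm (l *: g) <= `|l| * dual_norm g.
  apply: dual_norm_le => x x1; rewrite dualZE normrZ.
  by rewrite ler_wpM2l// dual_norm_ub.
apply/eqP; rewrite eq_le le /=.
have [->|k0] := eqVneq k 0; first by rewrite normr0 mul0r dual_norm_ge0.
have := le k^-1 (k *: f); rewrite scalerA mulVf// scale1r normfV.
by rewrite ler_pdivlMl ?normr_gt0.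
Qed.

Lemma dual_norm0_eq0 (f : dual) : dual_norm f = 0 -> f = 0.
Proof.
move=> f0; apply: dual_eqP => x; apply/eqP; rewrite -normr_le0.
by have := ler_dual_norm f x; rewrite f0 mul0r.
Qed.

HB.instance Definition _ :=
  Lmodule_isNormed.Build R dual dual_normD dual_normZ dual_norm0_eq0.

Lemma dual_normE (f : dual) :
  `|f| = sup [set `|f x| | x in [set x : X | `|x| <= 1]].
Proof. by []. Qed.

Definition pairing (x : X) (y : dual) : R := y x.

End Dual.
Arguments dual {R} X.

(* The canonical map from X to its bidual is onto. *)
Definition reflexive_space {R : realType} (X : normedModType R) : Prop :=
  forall F : dual (dual X), exists x : X, forall y : dual X,
    pairing y F = pairing x y.

(* Functions into R `|` {+oo} are modelled as functions into \bar R that do not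
   take the value -oo; this is part of [Gamma0] and of [bipotential]. *)
Section ConvexFunctions.
Context {R : realType} {V : normedModType R}.
Local Open Scope ereal_scope.

Definition dom (psi : V -> \bar R) : set V := [set x | psi x \is a fin_num].

(* For t = 0 or t = 1 the inequality is trivially true, both for the library's
   convention 0 * +oo = 0 and for the convention 0 * +oo = +oo. *)
Definition convex_efun (psi : V -> \bar R) : Prop :=
  forall (x y : V) (t : R), (0 <= t <= 1)%R ->
    psi (t *: x + (1 - t) *: y)%R <= t%:E * psi x + (1 - t)%:E * psi y.

Definition Gamma0 (psi : V -> \bar R) : Prop :=
  [/\ forall x, psi x != -oo, convex_efun psi, lower_semicontinuous psi
    & dom psi !=set0].

End ConvexFunctions.

Section Bipotentials.
Context {R : realType} {X : normedModType R}.
Local Notation Y := (dual X).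
Local Open Scope ereal_scope.

Definition subdiff (psi : X -> \bar R) (x : X) : set Y :=
  [set u | dom psi x /\ forall z, (pairing (z - x)%R u)%:E <= psi z - psi x].

(* Subgradients of a function on the dual are taken in X, identified with the
   bidual when X is reflexive. *)
Definition subdiff_dual (psi : Y -> \bar R) (y : Y) : set X :=
  [set x | dom psi y /\ forall w, (pairing x (w - y)%R)%:E <= psi w - psi y].

Definition fenchel_conjugate (phi : X -> \bar R) (y : Y) : \bar R :=
  ereal_sup [set (pairing x y)%:E - phi x | x in [set: X]].

Definition bipotential (b : X -> Y -> \bar R) : Prop :=
  [/\ forall x y, b x y != -oo,
      (forall x, dom (b x) !=set0 -> Gamma0 (b x)) /\
      (forall y, dom (b ^~ y) !=set0 -> Gamma0 (b ^~ y)),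
      forall x y, (pairing x y)%:E <= b x y
    & forall x y,
        (subdiff (b ^~ y) x y <-> subdiff_dual (b x) y x) /\
        (subdiff_dual (b x) y x <-> b x y = (pairing x y)%:E)].

Definition bipotential_graph (b : X -> Y -> \bar R) : set (X * Y) :=
  [set p | b p.1 p.2 = (pairing p.1 p.2)%:E].

Definition blurred_graph (phi : X -> \bar R) (eps : R) : set (X * Y) :=
  [set p | exists a : Y, (`|a| <= eps)%R /\ subdiff phi p.1 (p.2 + a)%R].

Definition blurred_bifunction (phi : X -> \bar R) (eps : R) (x : X) (y : Y)
    : \bar R :=
  phi x + ereal_inf [set fenchel_conjugate phi (y - a)%R + (pairing x a)%:E
                    | a in [set a : Y | (`|a| <= eps)%R]].

End Bipotentials.

(* Main.v *)
Require Import Defs.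
From HB Require Import structures.
From mathcomp Require Import all_boot all_order all_algebra.
From mathcomp Require Import all_classical all_reals all_analysis.
From mathcomp Require Import ring lra.

Import Order.TTheory GRing.Theory Num.Theory.
Import numFieldNormedType.Exports.

Local Open Scope classical_set_scope.
Local Open Scope ring_scope.

(** Write g(x,y) for the infimum in b(x,y) = phi(x) + g(x,y), and <x,y> for the
pairing.  The whole argument rests on the dual formula
[[
  g(x,y) = sup_z (<z,y> - phi(z) - eps |z - x|),
]]
where the infimum defining g is attained: g(x,.) is the conjugate of
phi + eps |. - x|, and the conjugate of a sum whose second term is continuous is
an exact infimal convolution ([penalized_conjugate_attained]).  It follows from
Hahn-Banach in a sandwich form: between a convex f and a function - K |. - x|
below it there is an affine function of slope at most K
([convex_ge_norm_affine_minorant]).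

The dual formula yields the structural axioms.  For fixed x it is a supremum of
continuous affine functions of y, for fixed y a supremum of eps-Lipschitz
functions of x; after adding phi(x), both partial functions of b are lower
semicontinuous and b(x,.) is convex; convexity of b(.,y) is the hypothesis.
The Fenchel-Young inequality at y - a gives b(x,y) >= <x,y>, and equality there
at a minimizing a says that y - a is a subgradient of phi at x; since the ball
is symmetric, this is the description of the graph.

Where b(x,y) = <x,y>, the inequality b >= <.,.> turns into both subgradient
inequalities.  Conversely:
- if x is a subgradient of b(x,.) at y, then b(x,y) - <x,y> is a lower bound of
  b(x,w) - <x,w> over all w, and these values come arbitrarily close to 0,
  because phi, being convex and lower semicontinuous, has at x almost exact
  affine minorants ([convex_lsc_cone_minorant] and the sandwich again);
- if y is a subgradient of b(.,y) at x, then b(x,y) - <x,y> is a lower bound of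
  b(z,y) - <z,y> over all z.  Fix a in the ball with the conjugate of phi
  finite at y - a; then b(z,y) - <z,y> is at most the Fenchel-Young gap of phi
  at (z, y - a), whose infimum over z is 0 by definition of the conjugate. *)

(** * Hahn-Banach for sublinear functions *)

Definition sublinear {R : realType} {V : lmodType R} (q : V -> R) : Prop :=
  (forall x y, q (x + y) <= q x + q y) /\
  (forall t x, 0 <= t -> q (t *: x) = t * q x).

Definition convex_cone {R : realType} {V : lmodType R} (C : set (V * R)) :
    Prop :=
  [/\ C (0, 0),
      forall v r w s, C (v, r) -> C (w, s) -> C (v + w, r + s)
    & forall t v r, 0 <= t -> C (v, r) -> C (t *: v, t * r)].

Section HahnBanach.
Context {R : realType} {V : lmodType R}.
Implicit Types (p q : V -> R) (C : set (V * R)).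

Lemma sublinear_le q : (forall x y, q (x + y) <= q x + q y) ->
  (forall t x, 0 < t -> q (t *: x) <= t * q x) -> q 0 = 0 -> sublinear q.
Proof.
move=> qD qZ q0; split=> // t x; rewrite le_eqVlt => /predU1P[<-|t0].
  by rewrite scale0r mul0r.
apply/eqP; rewrite eq_le qZ//=.
have := qZ t^-1 (t *: x); rewrite invr_gt0 => /(_ t0).
by rewrite scalerA mulVf ?gt_eqF// scale1r ler_pdivlMl.
Qed.

Lemma sublinear0 q : sublinear q -> q 0 = 0.
Proof. by case=> _ /(_ 0 0 (lexx _)); rewrite scale0r mul0r. Qed.

Lemma sublinear_geN q x : sublinear q -> - q (- x) <= q x.
Proof.
move=> sq; have [/(_ x (- x)) + _] := sq.
by rewrite subrr sublinear0//; lra.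
Qed.

(** One computation for the two infima used below: over a cone, and over a
chain of sublinear functions.  The last hypothesis keeps the value at 0 from
dropping. *)
Lemma sublinear_inf (I : Type) (A : set I) (F : I -> V -> R) (m : V -> R) :
  A !=set0 -> (forall i x, A i -> m x <= F i x) ->
  (forall i j x y, A i -> A j ->
    exists2 k, A k & F k (x + y) <= F i x + F j y) ->
  (forall i t x, 0 < t -> A i -> exists2 k, A k & F k (t *: x) <= t * F i x) ->
  inf [set F i 0 | i in A] = 0 ->
  sublinear (fun x => inf [set F i x | i in A]).
Proof.
move=> [i0 Ai0] mF FD FZ F0.
have infle i x : A i -> inf [set F i x | i in A] <= F i x.
  move=> Ai; apply: ge_inf; last by exists i.
  by exists (m x) => _ [j Aj <-]; exact: mF.
have leinf x c : (forall i, A i -> c <= F i x) -> c <= inf [set F i x | i in A].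
  move=> cF; apply: lb_le_inf; first by exists (F i0 x), i0.
  by move=> _ [i Ai <-]; exact: cF.
apply: sublinear_le => // [x y|t x t0].
- rewrite -lerBlDr; apply: (leinf) => i Ai; rewrite lerBlDr -lerBlDl.
  apply: (leinf) => j Aj; rewrite lerBlDl.
  by have [k Ak] := FD i j x y Ai Aj; apply: le_trans; exact: (infle).
- rewrite -ler_pdivrMl//; apply: (leinf) => i Ai; rewrite ler_pdivrMl//.
  by have [k Ak] := FZ i t x t0 Ai; apply: le_trans; exact: infle.
Qed.

(** The function x |-> inf_{(v,r) in C} (q(x - v) + r) is the largest sublinear
function that is below q and satisfies the constraints of C; the compatibility
condition between q and C is what makes it finite. *)
Lemma sublinear_below_cone q C : sublinear q -> convex_cone C ->
  (forall v r, C (v, r) -> 0 <= q (- v) + r) ->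
  exists q', [/\ sublinear q', forall x, q' x <= q x
               & forall v r, C (v, r) -> q' v <= r].
Proof.
move=> sq [C0 CD CZ] qC; have [qD qZ] := sq.
pose F (c : V * R) x := q (x - c.1) + c.2.
have mF c x : C c -> - q (- x) <= F c x.
  case: c => v r /qC; rewrite /F /=.
  by have := qD (x - v) (- x); rewrite addrAC subrr add0r; lra.
have infle c x : C c -> inf [set F c x | c in C] <= F c x.
  move=> Cc; apply: ge_inf; last by exists c.
  by exists (- q (- x)) => _ [d Cd <-]; exact: mF.
exists (fun x => inf [set F c x | c in C]); split.
- apply: (@sublinear_inf _ _ _ (fun x => - q (- x))) => //.
  + by exists (0, 0).
  + move=> [v r] [w s] x y Cv Cw; exists (v + w, r + s); first exact: CD.
    rewrite /F /=; have := qD (x - v) (y - w).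
    by rewrite opprD addrACA; lra.
  + move=> [v r] t x t0 Cv; exists (t *: v, t * r); first exact/CZ/Cv/ltW.
    by rewrite /F /= -scalerBr qZ ?(ltW t0) // mulrDr.
  + apply/eqP; rewrite eq_le (le_trans (infle (0, 0) _ _))//=; last first.
      by rewrite /F /= subr0 addr0 sublinear0.
    apply: lb_le_inf; first by exists (F (0, 0) 0), (0, 0).
    by move=> _ [[v r] Cv <-]; rewrite /F /= sub0r; exact: qC.
- by move=> x; have := infle (0, 0) x C0; rewrite /F /= subr0 addr0.
- move=> v r Cv; have := infle _ v Cv.
  by rewrite /F /= subrr sublinear0// add0r.
Qed.

(** Zorn's lemma for the reverse pointwise order: the infimum of a chain is
again sublinear, and it is finite since every sublinear q <= p satisfies
q x >= - q (- x) >= - p (- x). *)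
Lemma exists_minimal_sublinear p : sublinear p ->
  exists q, [/\ sublinear q, forall x, q x <= p x
    & forall q', sublinear q' -> (forall x, q' x <= q x) -> q' = q].
Proof.
move=> sp.
pose P (q : V -> R) := sublinear q /\ forall x, q x <= p x.
pose T := {q : V -> R | P q}.
pose r (s t : T) := `[< forall x, sval t x <= sval s x >].
have [| | |A Atot|[q [sq qp]] qmin] := @Zorn T r.
- by move=> t; apply/asboolP => x.
- move=> s t u /asboolP st /asboolP tu; apply/asboolP => x.
  exact: le_trans (tu x) (st x).
- move=> [s hs] [t ht] /asboolP /= st /asboolP /= ts; apply: eq_exist.
  by apply/funext => x; apply/eqP; rewrite eq_le ts st.
- have [->|/set0P[q0 Aq0]] := eqVneq A set0.
    by exists (exist P p (conj sp (fun=> lexx _))).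
  have mF (q : T) x : A q -> - p (- x) <= sval q x.
    case: q => q /= [sq qp] _; apply: le_trans (sublinear_geN q x sq).
    by rewrite lerN2.
  have infle (q : T) x : A q -> inf [set sval q x | q in A] <= sval q x.
    move=> Aq; apply: ge_inf; last by exists q.
    by exists (- p (- x)) => _ [d Ad <-]; exact: mF.
  have sinf : sublinear (fun x => inf [set sval q x | q in A]).
    apply: (@sublinear_inf T _ _ (fun x => - p (- x))) => //.
    + by exists q0.
    + move=> s t x y As At; have [/asboolP ts|/asboolP st] := Atot s t As At.
      * exists t => //; have [[/(_ x y) + _] _] := svalP t.
        by have := ts x; lra.
      * exists s => //; have [[/(_ x y) + _] _] := svalP s.
        by have := st y; lra.
    + move=> s t x t0 As; exists s => //.
      by have [[_ sZ] _] := svalP s; rewrite sZ// ltW.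
    + rewrite (_ : [set _ | _ in _] = [set 0]) ?inf1//.
      apply/seteqP; split=> [_ [s As <-]|_ ->] /=.
        by rewrite sublinear0//; case: (svalP s).
      by exists q0 => //; rewrite sublinear0//; case: (svalP q0).
  have infp x : inf [set sval q x | q in A] <= p x.
    by apply: le_trans (infle _ x Aq0) _; case: (svalP q0).
  exists (exist P _ (conj sinf infp)) => s As; apply/asboolP => x /=.
  exact: infle.
exists q; split=> // q' sq' q'q.
have q'p x : q' x <= p x by exact: le_trans (qp x).
suff /(congr1 sval) :
  exist P q' (conj sq' q'p) = exist P q (conj sq qp) :> T by [].
by apply: qmin; apply/asboolP.
Qed.

(** By minimality, the constraint q'(- v) <= - q(v) can be imposed on q without
changing it, so q is odd; an odd subadditive function is additive. *)
Lemma minimal_sublinear_linear q : sublinear q ->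
  (forall q', sublinear q' -> (forall x, q' x <= q x) -> q' = q) ->
  forall t x y, q (t *: x + y) = t * q x + q y.
Proof.
move=> sq qmin; have [qD qZ] := sq.
have qN v : q (- v) = - q v.
  (* The ray spanned by (- v, - q v). *)
  pose C := [set c : V * R | exists2 t, 0 <= t & c = (t *: - v, t * - q v)].
  have [||q' [sq' q'q q'C]] := @sublinear_below_cone q C sq.
  - split; first by exists 0; rewrite // scale0r mul0r.
      move=> _ _ _ _ [t t0 [-> ->]] [u u0 [-> ->]]; exists (t + u).
        by rewrite addr_ge0.
      by rewrite scalerDl mulrDl.
    move=> t _ _ t0 [u u0 [-> ->]]; exists (t * u); first by rewrite mulr_ge0.
    by rewrite scalerA mulrA.
  - by move=> _ _ [t t0 [-> ->]]; rewrite -scalerN opprK qZ//; lra.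
  rewrite (qmin _ sq' q'q) in q'C; apply/eqP; rewrite eq_le; apply/andP; split.
    by apply: q'C; exists 1; rewrite // scale1r mul1r.
  by rewrite lerNl; exact: sublinear_geN.
have qA x y : q (x + y) = q x + q y.
  apply/eqP; rewrite eq_le qD/= -(opprK (x + y)) qN opprD.
  by have := qD (- x) (- y); rewrite !qN; lra.
move=> t x y; rewrite qA; congr (_ + _).
have [t0|t0] := leP 0 t; first exact: qZ.
by rewrite -(opprK t) scaleNr qN qZ; [rewrite !mulNr|rewrite oppr_ge0 ltW].
Qed.

(** Hahn-Banach with a cone C of prescribed upper bounds on l: with C the cone
over the epigraph of a convex function it becomes a separation theorem. *)
Lemma hahn_banach_cone p C : sublinear p -> convex_cone C ->
  (forall v r, C (v, r) -> 0 <= p (- v) + r) ->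
  exists l : V -> R, [/\ forall t x y, l (t *: x + y) = t * l x + l y,
    forall x, l x <= p x & forall v r, C (v, r) -> l v <= r].
Proof.
move=> sp CC pC; have [q [sq qp qC]] := sublinear_below_cone _ _ sp CC pC.
have [l [sl lq lmin]] := exists_minimal_sublinear _ sq.
exists l; split.
- exact: minimal_sublinear_linear.
- by move=> x; exact: le_trans (lq x) (qp x).
- by move=> v r /qC; exact: le_trans (lq v).
Qed.

End HahnBanach.

(** * Duality pairing *)

Section Pairing.
Context {R : realType} {X : normedModType R}.
Implicit Types (x z : X) (y a : dual X).

Lemma pairingDl x z y : pairing (x + z) y = pairing x y + pairing z y.
Proof. exact: linearD. Qed.

Lemma pairingBl x z y : pairing (x - z) y = pairing x y - pairing z y.
Proof. exact: linearB. Qed.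

Lemma pairingZl k x y : pairing (k *: x) y = k * pairing x y.
Proof. exact: linearZ. Qed.

Lemma pairingDr x y a : pairing x (y + a) = pairing x y + pairing x a.
Proof. by []. Qed.

Lemma pairingZr x k y : pairing x (k *: y) = k * pairing x y.
Proof. by []. Qed.

Lemma pairingNr x y : pairing x (- y) = - pairing x y.
Proof. by rewrite -scaleN1r pairingZr mulN1r. Qed.

Lemma pairingBr x y a : pairing x (y - a) = pairing x y - pairing x a.
Proof. by rewrite pairingDr pairingNr. Qed.

Lemma ler_pairing x y : `|pairing x y| <= `|y| * `|x|.
Proof. exact: ler_dual_norm. Qed.

Lemma exists_dual (l : X -> R) (K : R) :
  0 <= K ->
  (forall t x z, l (t *: x + z) = t * l x + l z) ->
  (forall x, l x <= K * `|x|) ->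
  exists2 y : dual X, `|y| <= K & forall x, pairing x y = l x.
Proof.
move=> K0 llin lK.
have lN x : l (- x) = - l x.
  have l0 : l 0 = 0 by have := llin 1 0 0; rewrite scale1r addr0; lra.
  by have := llin (-1) x 0; rewrite scaleN1r !addr0 l0; lra.
have lnorm x : `|l x| <= K * `|x|.
  by rewrite ler_norml lK andbT lerNl -lN -[in leRHS](normrN x).
pose lM := GRing.isLinear.Build R X R^o *:%R (l : X -> R^o) llin.
pose L : {linear X -> R^o} := HB.pack (l : X -> R^o) lM.
have lcont : continuous (l : X -> R^o).
  apply: (@bounded_linear_continuous R X R^o L).
  apply/linear_boundedP; exists K; split; first exact: num_real.
  move=> r Kr x; apply: le_trans (lnorm x) _.
  by rewrite ler_wpM2r// ltW.
have ldual : (l : X -> R^o) \in dual_pred by rewrite inE; split.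
exists (Dual ldual) => //; apply: dual_norm_le => x x1.
apply: le_trans (lnorm x) _.
by rewrite ler_piMr.
Qed.

End Pairing.

(** * Affine minorants of convex functions *)

Section ConvexMinorants.
Context {R : realType} {X : normedModType R}.
Local Open Scope ereal_scope.
Implicit Types (f : X -> \bar R).

Lemma convex_efun_le f x z s r (t : R) : convex_efun f -> (0 <= t <= 1)%R ->
  f x <= s%:E -> f z <= r%:E ->
  f (t *: x + (1 - t) *: z)%R <= (t * s + (1 - t) * r)%:E.
Proof.
move=> cf /andP[t0 t1] fxs fzr; apply: le_trans (cf x z t _) _.
  exact/andP.
rewrite [leRHS](_ : _ = t%:E * s%:E + (1 - t)%:E * r%:E)//.
by apply: leeD; apply: lee_wpmul2l => //; rewrite lee_fin subr_ge0.
Qed.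

(** The cone spanned by the epigraph of f translated by (- x, 0): a linear form
l respects its constraints exactly when l(z - x) <= f(z) for all z. *)
Lemma convex_cone_epigraph f x :
  convex_efun f -> dom f !=set0 ->
  convex_cone [set c : X * R | exists t z s, [/\ (0 <= t)%R, f z <= s%:E
    & c = (t *: (z - x), t * s)%R]].
Proof.
move=> cf [z0 fz0]; split.
- exists 0%R, z0, (fine (f z0)); split; rewrite ?fineK//.
  by rewrite scale0r mul0r.
- move=> _ _ _ _ [t [z [s [t0 fz [-> ->]]]]] [u [w [r [u0 fw [-> ->]]]]].
  have [tu0|tu0] := eqVneq (t + u)%R 0%R.
    have -> : t = 0%R by lra.
    have -> : u = 0%R by lra.
    by exists 0%R, z, s; split; rewrite ?scale0r ?mul0r ?addr0.
  have tu_gt0 : (0 < t + u)%R by rewrite lt_neqAle eq_sym tu0 addr_ge0.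
  have [k [k01 tk uk]] : exists k, [/\ (0 <= k <= 1)%R,
      ((t + u) * k = t)%R & ((t + u) * (1 - k) = u)%R].
    exists (t / (t + u))%R; split; [|by field|by field].
    rewrite ler_pdivrMr// mul1r lerDl u0 andbT.
    by apply: divr_ge0 => //; exact: ltW.
  exists (t + u)%R, (k *: z + (1 - k) *: w)%R, (k * s + (1 - k) * r)%R; split.
  + exact: addr_ge0.
  + exact: convex_efun_le.
  + congr (_, _); last by rewrite mulrDr !mulrA tk uk.
    rewrite !scalerBr scalerDr !scalerA tk uk scalerDl.
    by rewrite addrACA -opprD.
- move=> t _ _ t0 [u [z [s [u0 fz [-> ->]]]]]; exists (t * u)%R, z, s.
  split => //.
  + exact: mulr_ge0.
  + by rewrite scalerA mulrA.
Qed.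

(** Sandwich theorem for a convex f above a downward norm cone of slope K with
apex (x, 0).  The linear form l provided by Hahn-Banach satisfies l <= K |.| and
l(z - x) <= f(z), so a = - l has the required properties. *)
Lemma convex_ge_norm_affine_minorant f x (K : R) :
  convex_efun f -> dom f !=set0 -> (0 <= K)%R ->
  (forall z, (- (K * `|z - x|))%:E <= f z) ->
  exists2 a : dual X, (`|a| <= K)%R & forall z, (pairing (x - z)%R a)%:E <= f z.
Proof.
move=> cf df K0 fK.
have sK : sublinear (fun w : X => K * `|w|)%R.
  split=> [w z|t w t0]; first by rewrite -mulrDr ler_wpM2l// ler_normD.
  by rewrite normrZ ger0_norm// mulrCA.
have CC := convex_cone_epigraph f x cf df.
have [|l [llin lK lf]] := hahn_banach_cone _ _ sK CC.
  move=> _ _ [t [z [s [t0 fz [-> ->]]]]].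
  rewrite normrN normrZ ger0_norm// mulrCA -mulrDr mulr_ge0//.
  by have := le_trans (fK z) fz; rewrite lee_fin; lra.
have [y yK yl] := exists_dual _ _ K0 llin lK.
exists (- y)%R; first by rewrite normrN.
move=> z; case fzE: (f z) => [s| |]; last 2 first.
- by rewrite leey.
- by have := fK z; rewrite fzE.
have /lf : [set c : X * R | exists t z s, [/\ (0 <= t)%R, f z <= s%:E
    & c = (t *: (z - x), t * s)%R]] ((z - x)%R, s).
  by exists 1%R, z, s; split; rewrite ?fzE// scale1r mul1r.
by rewrite -yl lee_fin pairingNr !pairingBl; lra.
Qed.

(** Near x the bound r < f follows from lower semicontinuity.  Far from x, the
segment from x to z meets the neighbourhood where f > r, and convexity along it
bounds f(z) below by an affine function of |z - x|. *)
Lemma convex_lsc_cone_minorant f x (s r : R) :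
  convex_efun f -> (forall z, f z != -oo) -> lower_semicontinuous f ->
  f x = s%:E -> (r < s)%R ->
  exists2 K : R, (0 <= K)%R & forall z, (r - K * `|z - x|)%:E <= f z.
Proof.
move=> cf fNy lf fx rs.
have [|V /nbhs_ballP[d /= d0 dV] Vr] := lf x r; first by rewrite fx lte_fin.
exists (2 * (s - r) / d)%R.
  by rewrite divr_ge0// ?(ltW d0)// mulr_ge0// subr_ge0 ltW.
move=> z; have [zd|dz] := ltP `|z - x|%R d.
  apply: le_trans (ltW (Vr z _)).
    rewrite lee_fin gerBl mulr_ge0// divr_ge0 ?(ltW d0)//.
    by rewrite mulr_ge0// subr_ge0 ltW.
  by apply: dV; rewrite -ball_normE /= distrC.
case fzE: (f z) => [v| |]; [|by rewrite leey|by have := fNy z; rewrite fzE].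
have n0 : (0 < `|z - x|)%R by exact: lt_le_trans dz.
(* Then t z + (1 - t) x lies at distance d / 2 from x. *)
pose t := (d / (2 * `|z - x|))%R.
have t0 : (0 < t)%R by rewrite divr_gt0// mulr_gt0.
have t1 : (t <= 1)%R by rewrite ler_pdivrMr ?mulr_gt0// mul1r; lra.
pose u := (t *: z + (1 - t) *: x)%R.
have ru : r%:E < f u.
  apply/Vr/dV; rewrite -ball_normE /= distrC.
  have -> : (u - x = t *: (z - x))%R.
    by rewrite /u scalerBl scale1r scalerBr addrA addrAC addrK.
  rewrite normrZ gtr0_norm//.
  have -> : (t * `|z - x| = d / 2)%R by rewrite /t; field; rewrite gt_eqF.
  lra.
have := lt_le_trans ru (convex_efun_le f z x v s t cf _ _ _).
rewrite fzE fx !lexx t1 (ltW t0) => /(_ isT isT isT).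
rewrite lte_fin lee_fin => rts.
have -> : (2 * (s - r) / d * `|z - x| = (s - r) / t)%R.
  by rewrite /t; field; rewrite !gt_eqF.
have : ((s - r) / t >= s - v)%R by rewrite ler_pdivlMr//; lra.
lra.
Qed.

End ConvexMinorants.

(** * Stability of lower semicontinuity and convexity *)

Section ConvexLscClosure.
Context {R : realType} {V : normedModType R}.
Local Open Scope ereal_scope.
Implicit Types (f g : V -> \bar R).

Lemma lower_semicontinuous_sup (I : Type) (A : set I) (F : I -> V -> \bar R) :
  (forall i, A i -> lower_semicontinuous (F i)) ->
  lower_semicontinuous (fun v => ereal_sup [set F i v | i in A]).
Proof.
move=> lF v a /ereal_sup_gt[_ [i Ai <-]] /(lF i Ai)[U Uv aU].
exists U => // w /aU /lt_le_trans; apply; apply: ereal_sup_ubound.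
by exists i.
Qed.

Lemma lower_semicontinuousD f g :
  (forall v, f v != -oo) -> (forall v, g v != -oo) ->
  lower_semicontinuous f -> lower_semicontinuous g ->
  lower_semicontinuous (fun v => f v + g v).
Proof.
move=> fNy gNy lf lg v a afg.
(* Split the level a between f and g. *)
have [c [cf cg]] : exists c : R, c%:E < f v /\ (a - c)%:E < g v.
  move: afg (fNy v) (gNy v); case: (f v) (g v) => [s| |] [r| |]//= + _ _.
  - rewrite -EFinD lte_fin => asr; exists (s - (s + r - a) / 2)%R.
    by rewrite !lte_fin; lra.
  - by move=> _; exists (s - 1)%R; rewrite ltry lte_fin; split=> //; lra.
  - by move=> _; exists (a - r + 1)%R; rewrite ltry lte_fin; split=> //; lra.
  - by move=> _; exists 0%R; rewrite !ltry.
have [U Uv cU] := lf v c cf; have [W Wv cW] := lg v _ cg.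
exists (U `&` W); first exact: filterI.
move=> w [/cU cfw /cW cgw].
rewrite (_ : a%:E = c%:E + (a - c)%:E); first exact: lteD.
by rewrite -EFinD addrC subrK.
Qed.

Lemma lipschitz_lower_semicontinuous (h : V -> R) (K : R) : (0 <= K)%R ->
  (forall v w, h v - h w <= K * `|v - w|)%R -> lower_semicontinuous (EFin \o h).
Proof.
move=> K0 hK v a /=; rewrite lte_fin => av.
have K1 : (0 < K + 1)%R by lra.
exists (ball v ((h v - a) / (K + 1))).
  by apply: nbhsx_ballx; rewrite divr_gt0// subr_gt0.
move=> w; rewrite -ball_normE /= ltr_pdivlMr// lte_fin => vw.
have := hK v w; have := normr_ge0 (v - w)%R; lra.
Qed.

Lemma convex_efun_sup (I : Type) (A : set I) (F : I -> V -> \bar R) :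
  (forall i, A i -> convex_efun (F i)) ->
  convex_efun (fun v => ereal_sup [set F i v | i in A]).
Proof.
move=> cF v w t t01; apply: ge_ereal_sup => _ [i Ai <-].
apply: le_trans (cF i Ai v w t t01) _; case/andP: t01 => t0 t1.
have leF u : F i u <= ereal_sup [set F i u | i in A].
  by apply: ereal_sup_ubound; exists i.
by apply: leeD; apply: lee_wpmul2l => //; rewrite lee_fin subr_ge0.
Qed.

Lemma convex_efunDl (s : R) f : (forall v, f v != -oo) ->
  convex_efun f -> convex_efun (fun v => s%:E + f v).
Proof.
move=> fNy cf v w t t01; have /andP[t0 t1] := t01.
have sE : s%:E = t%:E * s%:E + (1 - t)%:E * s%:E.
  by rewrite -!EFinM -EFinD; congr EFin; ring.
rewrite !muleDr// addeACA -sE.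
by apply: leeD => //; exact: cf.
Qed.

End ConvexLscClosure.

(** * The blurred bifunction *)

Section PenalizedConjugate.
Context {R : realType} {X : normedModType R}.
Local Open Scope ereal_scope.
Context (phi : X -> \bar R) (eps : R).
Context (hphi : Gamma0 phi) (eps0 : (0 < eps)%R).
Implicit Types (x z : X) (y a : dual X).

Local Notation conj := (fenchel_conjugate phi).

Let phiNy x : phi x != -oo. Proof. by case: hphi. Qed.
Let cphi : convex_efun phi. Proof. by case: hphi. Qed.
Let lphi : lower_semicontinuous phi. Proof. by case: hphi. Qed.
Let dphi : dom phi !=set0. Proof. by case: hphi. Qed.

Lemma fenchel_conjugate_le y (c : R) :
  conj y <= c%:E <-> forall z, (pairing z y - c)%:E <= phi z.
Proof.
split=> [yc z|yc].
  have : (pairing z y)%:E - phi z <= c%:E.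
    by apply: le_trans yc; apply: ereal_sup_ubound; exists z.
  case: (phi z) (phiNy z) => [s| |]//= _; last by rewrite leey.
  by rewrite -EFinB !lee_fin; lra.
apply: ge_ereal_sup => _ [z _ <-].
have := yc z; case: (phi z) (phiNy z) => [s| |]//= _; last by rewrite leNye.
by rewrite -EFinB !lee_fin; lra.
Qed.

Lemma fenchel_young x y : (pairing x y)%:E <= phi x + conj y.
Proof.
have : (pairing x y)%:E - phi x <= conj y by apply: ereal_sup_ubound; exists x.
case: (phi x) (phiNy x) => [s| |]// _; first by rewrite leeBlDl.
move=> _; rewrite addye ?leey//.
have [z fz] := dphi.
have : (pairing z y)%:E - phi z <= conj y by apply: ereal_sup_ubound; exists z.
by rewrite -(fineK fz) -EFinB; case: (conj y).
Qed.

Lemma fenchel_conjugateNy y : conj y != -oo.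
Proof.
have [z fz] := dphi; have := fenchel_young z y.
by rewrite -(fineK fz); case: (conj y).
Qed.

(** The conjugate of phi + eps |. - x|, with the supremum restricted to the
domain of phi so that all its terms are real. *)
Definition penalized_conjugate x y : \bar R :=
  ereal_sup [set (pairing z y - fine (phi z) - eps * `|z - x|)%:E
            | z in dom phi].

Local Notation pconj := penalized_conjugate.

Lemma penalized_conjugateNy x y : pconj x y != -oo.
Proof.
have [z fz] := dphi.
have : (pairing z y - fine (phi z) - eps * `|z - x|)%:E <= pconj x y.
  by apply: ereal_sup_ubound; exists z.
by case: (pconj x y).
Qed.

Lemma penalized_conjugate_le x y a : (`|a| <= eps)%R ->
  pconj x y <= conj (y - a)%R + (pairing x a)%:E.
Proof.
move=> aeps; apply: ge_ereal_sup => _ [z fz <-].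
rewrite -leeBlDr// -EFinB.
have := fenchel_young z (y - a)%R; rewrite -(fineK fz).
rewrite -leeBlDl// -EFinB; apply: le_trans; rewrite fineK// lee_fin.
have := ler_pairing (z - x)%R a; rewrite ler_norml => /andP[_].
have := ler_wpM2r (normr_ge0 (z - x)%R) aeps.
by rewrite pairingBr pairingBl; lra.
Qed.

(** If the supremum is c, then z |-> phi(z) + c - <z,y> is a convex function
above - eps |z - x|.  An affine function z |-> <x - z,a> between them has
|a| <= eps, and lying below the former it gives <z,y - a> - phi(z) <= c - <x,a>
for all z, which bounds the conjugate at y - a. *)
Lemma penalized_conjugate_attained x y : exists2 a, (`|a| <= eps)%R &
  conj (y - a)%R + (pairing x a)%:E = pconj x y.
Proof.
suff [a aeps ale] : exists2 a, (`|a| <= eps)%R &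
    conj (y - a)%R + (pairing x a)%:E <= pconj x y.
  by exists a => //; apply/eqP; rewrite eq_le ale penalized_conjugate_le.
case pE: (pconj x y) (penalized_conjugateNy x y) => [c| |]// _; last first.
  by exists 0%R; [rewrite normr0 ltW|rewrite leey].
pose f z := phi z + (c - pairing z y)%:E.
have cf : convex_efun f.
  move=> z w t t01; have /andP[t0 t1] := t01.
  rewrite /f !muleDr ?fin_num_adde_defl//.
  rewrite addeACA; apply: leeD; first exact: cphi.
  rewrite -!EFinM -EFinD lee_fin.
  by rewrite pairingDl !pairingZl; lra.
have df : dom f !=set0.
  by have [z fz] := dphi; exists z; rewrite /dom/= /f fin_numD fz.
have [|a aeps fa] := convex_ge_norm_affine_minorant f x eps cf df (ltW eps0).
  move=> z; rewrite /f; case phiz: (phi z) (phiNy z) => [s| |]// _; last first.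
    by rewrite leey.
  have : (pairing z y - s - eps * `|z - x|)%:E <= c%:E.
    rewrite -pE; apply: ereal_sup_ubound; exists z.
      by rewrite /dom /= phiz.
    by rewrite phiz.
  by rewrite -EFinD !lee_fin; lra.
exists a => //; rewrite -leeBrDr// -EFinB.
apply/fenchel_conjugate_le => z; have := fa z.
rewrite /f; case: (phi z) (phiNy z) => [s| |]// _; last by rewrite !leey.
by rewrite -EFinD !lee_fin pairingBr pairingBl; lra.
Qed.

Lemma blurred_bifunctionE x y :
  blurred_bifunction phi eps x y = phi x + pconj x y.
Proof.
congr (_ + _); apply/eqP; rewrite eq_le; apply/andP; split.
  have [a aeps <-] := penalized_conjugate_attained x y.
  by apply: ereal_inf_lbound; exists a.
by apply: le_ereal_inf_tmp => _ [a aeps <-]; exact: penalized_conjugate_le.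
Qed.

Lemma blurred_bifunction_le x y a : (`|a| <= eps)%R ->
  blurred_bifunction phi eps x y <= phi x + (conj (y - a)%R + (pairing x a)%:E).
Proof.
by move=> aeps; rewrite blurred_bifunctionE leeD2l// penalized_conjugate_le.
Qed.

Lemma blurred_bifunctionNy x y : blurred_bifunction phi eps x y != -oo.
Proof.
rewrite blurred_bifunctionE adde_eq_ninfty negb_or phiNy.
exact: penalized_conjugateNy.
Qed.

Lemma blurred_bifunction_ge x y :
  (pairing x y)%:E <= blurred_bifunction phi eps x y.
Proof.
rewrite blurred_bifunctionE.
have [a aeps <-] := penalized_conjugate_attained x y.
rewrite addeA -leeBlDr// -EFinB.
by rewrite -pairingBr fenchel_young.
Qed.

Lemma blurred_bifunction_dom x y : dom (blurred_bifunction phi eps x) y ->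
  phi x \is a fin_num /\ pconj x y \is a fin_num.
Proof.
by rewrite /dom/= blurred_bifunctionE fin_numD => /andP.
Qed.

Lemma convex_penalized_conjugate x : convex_efun (pconj x).
Proof.
apply: convex_efun_sup => z _ y w t _.
rewrite -!EFinM -EFinD lee_fin pairingDr !pairingZr le_eqVlt.
by apply/orP; left; apply/eqP; ring.
Qed.

Lemma lsc_penalized_conjugatel x : lower_semicontinuous (pconj x).
Proof.
apply: lower_semicontinuous_sup => z _.
apply: (@lipschitz_lower_semicontinuous _ _ _ `|z|%R) => // v w.
have := ler_pairing z (v - w)%R; rewrite ler_norml => /andP[_].
by rewrite pairingBr mulrC; lra.
Qed.

Lemma lsc_penalized_conjugater y : lower_semicontinuous (pconj ^~ y).
Proof.
apply: lower_semicontinuous_sup => z _.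
apply: (@lipschitz_lower_semicontinuous _ _ _ eps); first exact: ltW.
move=> v w; have : (`|z - w| <= `|v - w| + `|z - v|)%R.
  by have := ler_normD (v - w)%R (z - v)%R; rewrite addrC addrA subrK.
by rewrite -subr_ge0 => /(mulr_ge0 (ltW eps0)); lra.
Qed.

Lemma Gamma0_blurred_bifunctionl x :
  dom (blurred_bifunction phi eps x) !=set0 ->
  Gamma0 (blurred_bifunction phi eps x).
Proof.
move=> db; have [y /blurred_bifunction_dom[px _]] := db.
have bE : blurred_bifunction phi eps x = fun y => (fine (phi x))%:E + pconj x y.
  by apply/funext => w; rewrite fineK// blurred_bifunctionE.
split=> //; first exact: blurred_bifunctionNy.
- rewrite bE; apply: convex_efunDl; first exact: penalized_conjugateNy.
  exact: convex_penalized_conjugate.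
- rewrite bE; apply: lower_semicontinuousD => //.
  + exact: penalized_conjugateNy.
  + apply: (@lipschitz_lower_semicontinuous _ _ (fun=> fine (phi x)) 0%R) => //.
    by move=> v w; rewrite subrr mul0r.
  + exact: lsc_penalized_conjugatel.
Qed.

Lemma lsc_blurred_bifunctionr y :
  lower_semicontinuous (fun x => blurred_bifunction phi eps x y).
Proof.
rewrite (_ : (fun x => _) = fun x => phi x + pconj x y).
  apply: lower_semicontinuousD => //; last exact: lsc_penalized_conjugater.
  by move=> x; exact: penalized_conjugateNy.
by apply/funext => x; rewrite blurred_bifunctionE.
Qed.

(** An affine minorant of phi of slope - a that is e-exact at x makes b(x,.)
differ from the pairing by at most e at - a. *)
Lemma subdiff_dual_blurred_bifunction x y :
  subdiff_dual (blurred_bifunction phi eps x) y x <->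
  blurred_bifunction phi eps x y = (pairing x y)%:E.
Proof.
split=> [[db sb]|bxy]; last first.
  split; first by rewrite /dom /= bxy.
  move=> w; rewrite bxy leeBrDr// -EFinD pairingBr subrK.
  exact: blurred_bifunction_ge.
have [px _] := blurred_bifunction_dom _ _ db.
apply/eqP; rewrite eq_le blurred_bifunction_ge andbT.
apply/lee_addgt0Pr => e e0.
have rs : (fine (phi x) - e < fine (phi x))%R by lra.
have phix : phi x = (fine (phi x))%:E by rewrite fineK.
(* r - K |z - x| <= phi z with r = phi x - e. *)
have [K K0 fK] := convex_lsc_cone_minorant phi x _ _ cphi phiNy lphi phix rs.
set s := fine (phi x) in rs phix fK.
have cf : convex_efun (fun z => (- (s - e))%:E + phi z) by exact: convex_efunDl.
have df : dom (fun z => (- (s - e))%:E + phi z) !=set0.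
  by exists x; rewrite /dom /= phix.
have [|a _ fa] := convex_ge_norm_affine_minorant _ x K cf df K0.
  move=> z; have := fK z.
  case: (phi z) (phiNy z) => [v| |]// _; last by rewrite !leey.
  by rewrite -EFinD !lee_fin; lra.
have ca : conj (- a)%R <= (pairing x (- a) - (s - e))%:E.
  apply/fenchel_conjugate_le => z; have := fa z.
  case: (phi z) (phiNy z) => [v| |]// _; last by rewrite !leey.
  by rewrite -EFinD !lee_fin !pairingNr pairingBl; lra.
have ba : blurred_bifunction phi eps x (- a)%R <= (pairing x (- a) + e)%:E.
  have n0 : (`|0 : dual X| <= eps)%R by rewrite normr0 ltW.
  apply: le_trans (blurred_bifunction_le x (- a)%R _ n0) _.
  rewrite subr0 phix.
  apply: le_trans (leeD2l _ (leeD2r _ ca)) _.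
  have -> : pairing x (0%R : dual X) = 0%R by [].
  by rewrite -!EFinD lee_fin; lra.
have := sb (- a)%R.
rewrite -(fineK db) leeBrDr// -EFinD => /le_trans/(_ ba).
by rewrite -EFinD !lee_fin pairingBr; lra.
Qed.

(** Keep the minimizing a for (x,y) and take z almost maximizing
<z,y - a> - phi(z): then b(z,y) exceeds <z,y> by at most e. *)
Lemma subdiff_blurred_bifunction x y :
  subdiff (blurred_bifunction phi eps ^~ y) x y <->
  blurred_bifunction phi eps x y = (pairing x y)%:E.
Proof.
split=> [[db sb]|bxy]; last first.
  split; first by rewrite /dom /= bxy.
  move=> z; rewrite bxy leeBrDr// -EFinD pairingBl subrK.
  exact: blurred_bifunction_ge.
have [px qx] := blurred_bifunction_dom _ _ db.
apply/eqP; rewrite eq_le blurred_bifunction_ge andbT.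
apply/lee_addgt0Pr => e e0.
have [a aeps aE] := penalized_conjugate_attained x y.
have ca : conj (y - a)%R \is a fin_num.
  by move: qx; rewrite -aE fin_numD => /andP[].
have [_ [z _ <-] zlt] : exists2 u,
    [set (pairing z (y - a)%R)%:E - phi z | z in [set: X]] u
    & conj (y - a)%R - e%:E < u.
  by apply: ereal_sup_gt; rewrite -/(conj (y - a)%R) lteBlDr//
    -(fineK ca) -EFinD lte_fin ltrDl.
have := blurred_bifunction_le z y a aeps.
case phiz : (phi z) (phiNy z) zlt => [s| |]// _ zlt bz; last first.
  by move: zlt; rewrite ltNge leNye.
have := le_trans (sb z) (leeB bz (lexx _)).
move: zlt; rewrite -(fineK ca) -(fineK db) -?EFinD !lee_fin lte_fin.
by rewrite pairingBl pairingBr; lra.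
Qed.

(** Equality in b >= <.,.> is equality in the Fenchel-Young inequality at y - a
for a minimizing a, so - a is the perturbation that puts (x,y) in the blurred
graph. *)
Lemma blurred_bifunction_eq_pairing x y :
  blurred_bifunction phi eps x y = (pairing x y)%:E <->
  exists a, (`|a| <= eps)%R /\ subdiff phi x (y + a)%R.
Proof.
split=> [bxy|[a [aeps [px sx]]]].
  have [|px _] := blurred_bifunction_dom x y; first by rewrite /dom /= bxy.
  have [a aeps aE] := penalized_conjugate_attained x y.
  exists (- a)%R; split; first by rewrite normrN.
  split=> // z; move: bxy; rewrite blurred_bifunctionE -aE => bxy.
  have := fenchel_young z (y - a)%R.
  have := fenchel_conjugateNy (y - a)%R.
  move: bxy; rewrite -(fineK px).
  case: (conj (y - a)%R) => [c| |]// [bxy] _.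
  case: (phi z) (phiNy z) => [s| |]// _ ; last by rewrite !leey.
  by rewrite -!EFinD !lee_fin pairingBl !pairingBr; lra.
apply/eqP; rewrite eq_le blurred_bifunction_ge andbT.
have na : (`|- a| <= eps)%R by rewrite normrN.
apply: le_trans (blurred_bifunction_le x y _ na) _; rewrite opprK.
have [s phix] : exists s, phi x = s%:E by exists (fine (phi x)); rewrite fineK.
have ca : conj (y + a)%R <= (pairing x (y + a) - s)%:E.
  apply/fenchel_conjugate_le => z; have := sx z; rewrite phix.
  case: (phi z) (phiNy z) => [r| |]// _; last by rewrite !leey.
  by rewrite !lee_fin pairingBl; lra.
rewrite phix; apply: le_trans (leeD2l _ (leeD2r _ ca)) _.
by rewrite -!EFinD lee_fin pairingNr pairingDr; lra.
Qed.

End PenalizedConjugate.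

Theorem corollary1p2 (R : realType) (X : completeNormedModType R)
    (hX : reflexive_space X)
    (phi : X -> \bar R) (hphi : Gamma0 phi)
    (eps : R) (heps : 0 < eps)
    (hconv : forall y : dual X,
      convex_efun (fun x : X => blurred_bifunction phi eps x y)) :
  bipotential (blurred_bifunction phi eps) /\
  bipotential_graph (blurred_bifunction phi eps) = blurred_graph phi eps.
Proof.
split; last first.
  apply/seteqP; split=> -[x y];
    by case: (blurred_bifunction_eq_pairing phi eps hphi heps x y).
split.
- exact: blurred_bifunctionNy.
- split; first by move=> x; exact: Gamma0_blurred_bifunctionl.
  move=> y db; split=> //; last exact: lsc_blurred_bifunctionr.
  by move=> x; exact: blurred_bifunctionNy.
- exact: blurred_bifunction_ge.
- move=> x y.
  have b1 := subdiff_blurred_bifunction phi eps hphi heps x y.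
  have b2 := subdiff_dual_blurred_bifunction phi eps hphi heps x y.
  by split=> //; exact: iff_trans b1 (iff_sym b2).
Qed.
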